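(* Both of the following assertions are false. (a) For every $n$, an $n$-qubit permutation gate is in $\mathcal{C}_3$ if and only if it can be written as a product of pairwise commuting Toffoli gates, up to left and right multiplication by Clifford gates. (b) For every $n$ and every $k$, if $\pi\in\mathcal{C}_k$ is an $n$-qubit permutation gate, then $\pi^\dagger\in\mathcal{C}_k$.
   Context: Gates on $n$ qubits are unitary operators on $(\mathbb{C}^2)^{\otimes n}$, with computational basis $\{|v\rangle : v\in\mathbb{F}_2^n\}$. The Pauli group $\mathcal{P}_n$ consists of all $cP_1\otimes\cdots\otimes P_n$ with $c\in\{\pm1,\pm i\}$ and $P_j\in\{I_2,X,Y,Z\}$. The Clifford hierarchy: $\mathcal{C}_1=\mathcal{P}_n$, and for $k\ge2$, $\mathcal{C}_k$ is the set of unitaries $U$ with $UPU^\dagger\in\mathcal{C}_{k-1}$ for all $P\in\mathcal{P}_n$. $\mathcal{C}_2$ is the Clifford group. A permutation gate is a unitary whose matrix in the computational basis is a permutation matrix. For distinct $i,j,k$, the Toffoli gate $\mathrm{Tof}_{i,j,k}$ is the permutation gate replacing $a_k$ by $a_k+a_ia_j$ in $|a_1,\dots,a_n\rangle$ and fixing the other coordinates. *)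

(* Defs.v *)
From HB Require Import structures.
From mathcomp Require Import all_boot all_order all_algebra.
From mathcomp Require Import complex reals.

Set Implicit Arguments.
Unset Strict Implicit.
Unset Printing Implicit Defensive.

Import Order.TTheory GRing.Theory Num.Theory.
Local Open Scope ring_scope.
Local Open Scope complex_scope.
Local Open Scope sesquilinear_scope.

(* F_2^n, the labels of the computational basis *)
Notation bits n := 'rV['F_2]_n.

(* Operators on (C^2)^{\otimes n}, as matrices in the computational basis:
   |v> is the basis vector of index [enum_rank v]. *)
Notation gate R n := 'M[R[i]]_#|{: bits n}|.

Section Gates.
Context {R : realType} {n : nat}.
Implicit Types U P : gate R n.

(* The operator with entries <u|U|v> = f u v *)
Definition gate_of (f : bits n -> bits n -> R[i]) : gate R n :=
  \matrix_(a, b) f (enum_val a) (enum_val b).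

Definition pauliX : 'M[R[i]]_2 := delta_mx 0 1 + delta_mx 1 0.
Definition pauliY : 'M[R[i]]_2 := - 'i *: delta_mx 0 1 + 'i *: delta_mx 1 0.
Definition pauliZ : 'M[R[i]]_2 := delta_mx 0 0 - delta_mx 1 1.

Definition tensor (P : 'I_n -> 'M[R[i]]_2) : gate R n :=
  gate_of (fun u v => \prod_(j < n) P j (u 0 j) (v 0 j)).

Definition pauli_group U : Prop :=
  exists (c : R[i]) (P : 'I_n -> 'M[R[i]]_2),
    [/\ c \in [:: 1; - 1; 'i; - 'i],
        forall j, P j \in [:: 1%:M; pauliX; pauliY; pauliZ]
      & U = c *: tensor P].

(* Levels are numbered from 1; level 0 is empty by convention. *)
Fixpoint clifford_hierarchy (k : nat) U : Prop :=
  match k with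
  | 0 => False
  | 1 => pauli_group U
  | k'.+1 => U \is unitarymx /\
      forall P, pauli_group P -> clifford_hierarchy k' (U *m P *m U ^t*)
  end.

Definition clifford U : Prop := clifford_hierarchy 2 U.

Definition permutation_gate U : Prop := U \is unitarymx /\ is_perm_mx U.

Definition toffoli_map (i j k : 'I_n) (a : bits n) : bits n :=
  \row_l (if l == k then a 0 k + a 0 i * a 0 j else a 0 l).

Definition toffoli (i j k : 'I_n) : gate R n :=
  gate_of (fun u v => (u == toffoli_map i j k v)%:R).

Definition toffoli_gate U : Prop :=
  exists i j k : 'I_n, [/\ i != j, j != k, i != k & U = toffoli i j k].

Definition commuting_toffoli_product U : Prop :=
  exists s : seq (gate R n),
    [/\ {in s, forall T, toffoli_gate T},
        {in s &, forall T T', comm_mx T T'}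
      & U = \big[mulmx/1%:M]_(T <- s) T].

Definition commuting_toffoli_product_up_to_clifford U : Prop :=
  exists L V M : gate R n,
    [/\ clifford L, commuting_toffoli_product V, clifford M
      & U = L *m V *m M].

End Gates.

(* Main.v *)
(* In the commutative algebra F_2[e1,e2,e3]/(e1^2,e2^2,e3^2), every element 1 + x
   with x in the (7-dimensional) augmentation ideal V squares to 1, so these
   elements form an elementary abelian group; let exp : (F_2^7, +) -> V be the
   parametrization of it by exponents.  For the gate U of the permutation exp,
   U X^a U^-1 multiplies 1 + x by 1 + exp a, which is affine in x, and U Z^b U^-1 is
   diagonal with phase (-1)^(b . log x), where log = exp^-1 is quadratic because
   the cubic terms of its e1e2e3-coordinate cancel mod 2.  Both are Clifford, so
   U is in C_3.  The e1e2e3-coordinate of exp is cubic, so U^-1 is not in C_3,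
   which refutes (b).  For (a), if U = L V M with L, M Clifford and V a product of
   commuting Toffoli gates, then V^-1 = V and U^-1 = (M^-1 L^-1) U (M^-1 L^-1) would be
   in C_3. *)

Require Import Defs.
From HB Require Import structures.
From mathcomp Require Import all_boot all_order all_algebra.
From mathcomp Require Import complex reals.
From mathcomp Require Import perm ring.

Set Implicit Arguments.
Unset Strict Implicit.
Unset Printing Implicit Defensive.

Import Order.TTheory GRing.Theory Num.Theory.
Local Open Scope ring_scope.
Local Open Scope complex_scope.
Local Open Scope sesquilinear_scope.

(** * Arithmetic in characteristic 2 *)

Lemma F2_cases (x : 'F_2) : x = 0 \/ x = 1.
Proof.
by case: x => [[|[|m]] lt_m] //; [left | right]; apply: val_inj.
Qed.

Lemma F2_addrr (x : 'F_2) : x + x = 0.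
Proof. by case: (F2_cases x) => ->; apply: val_inj. Qed.

Lemma F2_oppr (x : 'F_2) : - x = x.
Proof. by apply/eqP; rewrite eq_sym -addr_eq0 F2_addrr. Qed.

Lemma bits_addrr n (x : bits n) : x + x = 0.
Proof. by apply/rowP => j; rewrite !mxE F2_addrr. Qed.

(** * Affine and quadratic maps between abelian groups *)

Section AffineMaps.

(** The three-point form needs no scalars and no normalisation at 0, so it passes directly to
    composites and inverses. *)
Definition affine (V W : zmodType) (f : V -> W) : Prop :=
  forall x y z, f (x + y - z) = f x + f y - f z.

Definition quadratic (V W : zmodType) (f : V -> W) : Prop :=
  forall a, affine (fun x => f (x + a) - f x).

Lemma affine_comp (U V W : zmodType) (f : V -> W) (g : U -> V) :
  affine f -> affine g -> affine (f \o g).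
Proof. by move=> af ag x y z /=; rewrite ag af. Qed.

Lemma affineD (V W : zmodType) (f g : V -> W) :
  affine f -> affine g -> affine (fun x => f x + g x).
Proof.
move=> af ag x y z; rewrite af ag opprD addrACA; congr (_ + _).
by rewrite addrACA.
Qed.

Lemma affine_inv (V W : zmodType) (f : V -> W) (g : W -> V) :
  cancel f g -> cancel g f -> affine f -> affine g.
Proof. by move=> fK gK af x y z; apply: (can_inj fK); rewrite af !gK. Qed.

(** An affine bijection conjugates translations to translations. *)
Lemma affine_translate (V W : zmodType) (f : V -> W) (g : W -> V) a x :
  cancel g f -> affine f -> f (g x + a) = x + (f a - f 0).
Proof. by move=> gK af; rewrite -[g x + a]subr0 af gK addrA. Qed.

Lemma quadratic_lincomb (V : zmodType) (K : comPzRingType) n (b : 'rV[K]_n)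
    (f : V -> 'rV[K]_n) :
  (forall j, quadratic (fun x => f x 0 j)) ->
  quadratic (fun x => \sum_j b 0 j * f x 0 j).
Proof.
move=> qf a x y z; rewrite -!sumrB -big_split -sumrB /=.
apply: eq_bigr => j _; have := qf j a x y z.
by rewrite -!mulrBr -mulrDr -mulrBr => ->.
Qed.

End AffineMaps.

Definition dot n (b x : bits n) : 'F_2 := \sum_j b 0 j * x 0 j.

Lemma dot_affine n (b : bits n) : affine (dot b).
Proof.
move=> x y z; rewrite /dot -big_split -sumrB; apply: eq_bigr => j _.
by rewrite !mxE mulrBr mulrDr.
Qed.

Lemma dot_0l n (x : bits n) : dot 0 x = 0.
Proof. by apply: big1 => j _; rewrite mxE mul0r. Qed.

Lemma dot_0r n (b : bits n) : dot b 0 = 0.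
Proof. by apply: big1 => j _; rewrite mxE mulr0. Qed.

(** The only scalars are 0 and 1, so the additive map [g x - g 0] is already linear. *)
Lemma affine_dot n (g : bits n -> 'F_2) :
  affine g -> exists b, forall x, g x = g 0 + dot b x.
Proof.
move=> ag; pose h x := g x - g 0.
have h0 : h 0 = 0 by rewrite /h subrr.
have hD : {morph h : x y / x + y}.
  by move=> x y; rewrite /h -[x + y]subr0 ag addrAC addrACA -addrA -opprD -addrA.
exists (\row_j h 'e_j) => x; rewrite -[LHS](subrK (g 0)) addrC; congr (_ + _).
rewrite -/(h x) [x in LHS]row_sum_delta (big_morph h hD h0).
apply: eq_bigr => j _; rewrite mxE.
by case: (F2_cases (x 0 j)) => ->; rewrite ?scale0r ?scale1r ?mulr0 ?mulr1.
Qed.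

(** * Signs and fourth roots of unity *)

Section Gates.
Context {R : realType} {n : nat}.
Implicit Types (U V L M P : gate R n) (c : R[i]) (x y : 'F_2).
Implicit Types (f g : bits n -> bits n) (q : bits n -> 'F_2) (a b : bits n).

Definition sgn x : R[i] := if x == 0 then 1 else -1.

Lemma sgn0 : sgn 0 = 1. Proof. by []. Qed.

Lemma sgn1 : sgn 1 = -1. Proof. by []. Qed.

Lemma sgnD x y : sgn (x + y) = sgn x * sgn y.
Proof.
by case: (F2_cases x) => ->; case: (F2_cases y) => ->;
  rewrite ?F2_addrr ?addr0 ?add0r ?sgn0 ?sgn1 ?mulr1 ?mul1r ?mulrNN ?mulr1.
Qed.

Lemma sgn_sum I (r : seq I) (F : I -> 'F_2) :
  sgn (\sum_(i <- r) F i) = \prod_(i <- r) sgn (F i).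
Proof. exact: (big_morph sgn sgnD sgn0). Qed.

Lemma sgn_neq0 x : sgn x != 0.
Proof.
by case: (F2_cases x) => ->; rewrite ?sgn1 ?sgn0 ?oppr_eq0 oner_eq0.
Qed.

Lemma sgn_conj x : (sgn x)^*%R = sgn x.
Proof. by case: (F2_cases x) => ->; rewrite ?sgn1 ?sgn0 ?conjCN1 ?conjC1. Qed.

Lemma sgn_inj : injective sgn.
Proof.
have nN1 : (1 == -1 :> R[i]) = false by rewrite -subr_eq0 opprK -(natrD _ 1 1) pnatr_eq0.
by move=> x y; case: (F2_cases x) => ->; case: (F2_cases y) => -> //;
  rewrite sgn0 sgn1 => /eqP; rewrite ?nN1 // eq_sym nN1.
Qed.

Definition phases : seq R[i] := [:: 1; -1; 'i%R; - 'i%R].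

Lemma phasesE c : (c \in phases) = (c ^+ 4 == 1).
Proof.
have -> : (c ^+ 4 == 1) = ((c ^+ 2 - 1) * (c ^+ 2 - 'i%R ^+ 2) == 0).
  by rewrite sqrCi -subr_eq0; congr (_ == 0); ring.
rewrite !inE mulf_eq0 subr_eq0 -(expr1n _ 2) eqf_sqr expr1n.
by rewrite subr_eq0 eqf_sqr !orbA.
Qed.

Lemma phasesM c d : c \in phases -> d \in phases -> c * d \in phases.
Proof. by rewrite !phasesE exprMn => /eqP -> /eqP ->; rewrite mulr1. Qed.

Lemma phases_sgn x : sgn x \in phases.
Proof. by case: (F2_cases x) => ->; rewrite !inE eqxx ?orbT. Qed.

Lemma phases_conj c : c \in phases -> c * c^*%R = 1.
Proof.
rewrite !inE => /or4P[] /eqP ->; rewrite ?(rmorphN, conjC1, conjCi) /=;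
  by rewrite ?(conjC1, conjCi, mulrNN, mulr1, mulrN, mulNr) -?expr2 ?sqrCi ?opprK.
Qed.

Lemma phases_conj_in c : c \in phases -> c^*%R \in phases.
Proof. by rewrite !phasesE -rmorphXn /= => /eqP ->; rewrite conjC1. Qed.

(** * Monomial gates *)

Lemma gate_of_mul (F G : bits n -> bits n -> R[i]) :
  gate_of F *m gate_of G = gate_of (fun u v => \sum_w F u w * G w v).
Proof.
apply/matrixP => i j; rewrite !mxE [RHS](reindex _ (onW_bij _ (enum_val_bij _))).
by apply: eq_bigr => k _; rewrite !mxE.
Qed.

Lemma gate_of_inj (F G : bits n -> bits n -> R[i]) :
  gate_of F = gate_of G -> F =2 G.
Proof.
move=> /matrixP eqFG u v; have := eqFG (enum_rank u) (enum_rank v).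
by rewrite !mxE !enum_rankK.
Qed.

Lemma eq_gate_of (F G : bits n -> bits n -> R[i]) :
  F =2 G -> gate_of F = gate_of G.
Proof. by move=> eqFG; apply/matrixP => i j; rewrite !mxE. Qed.

(* |v> is mapped to c (-1)^(q v) |f v>. *)
Definition monomial c q f : gate R n :=
  gate_of (fun u v => c * sgn (q v) * (u == f v)%:R).

Lemma eq_monomial c q q' f f' :
  q =1 q' -> f =1 f' -> monomial c q f = monomial c q' f'.
Proof. by move=> eq_q eq_f; apply: eq_gate_of => u v; rewrite eq_q eq_f. Qed.

Lemma monomial_mul c d q q' f f' :
  monomial c q f *m monomial d q' f' =
  monomial (c * d) (fun v => q' v + q (f' v)) (f \o f').
Proof.
rewrite gate_of_mul; apply: eq_gate_of => u v /=.
rewrite (bigD1 (f' v)) //= eqxx mulr1 big1 => [|w /negPf ->]; last first.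
  by rewrite !mulr0.
by rewrite addr0 sgnD; ring.
Qed.

Lemma monomial_adj c q f g : cancel f g -> cancel g f ->
  (monomial c q f)^t* = monomial c^*%R (q \o g) g.
Proof.
move=> fK gK; apply/matrixP => i j; rewrite !mxE /=.
rewrite !rmorphM /= sgn_conj conjC_nat [_ == g _]eq_sym (can2_eq gK fK).
by case: eqP => [->|]; rewrite ?fK ?mulr0.
Qed.

Lemma monomial_inj c d q q' f f' v : c != 0 ->
  monomial c q f = monomial d q' f' ->
  c * sgn (q v) = d * sgn (q' v) /\ f v = f' v.
Proof.
(* The left entry at row [f v], column [v] is nonzero, which forces [f' v = f v]. *)
move=> c_neq0 /gate_of_inj /(_ (f v) v); rewrite eqxx mulr1.
case: eqP => [-> | _]; rewrite ?mulr1 // mulr0 => /eqP.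
by rewrite mulf_eq0 (negPf c_neq0) (negPf (sgn_neq0 _)).
Qed.

Lemma monomial1 : monomial 1 (fun=> 0) id = 1%:M.
Proof.
apply/matrixP => i j; rewrite !mxE sgn0 !mul1r.
by rewrite (inj_eq (bij_inj (enum_val_bij _))).
Qed.

Lemma monomial_unitary c q f g : cancel f g -> cancel g f -> c \in phases ->
  monomial c q f \is unitarymx.
Proof.
move=> fK gK c_phase; apply/unitarymxP.
rewrite (monomial_adj _ _ fK gK) monomial_mul phases_conj // -monomial1.
by apply: eq_monomial => v /=; rewrite ?gK ?F2_addrr.
Qed.

(* Conjugating X^a Z^b by |v> -> (-1)^(q v) |f v>. *)
Lemma monomial_conj c d q f g a b : cancel f g -> cancel g f -> d \in phases ->
  monomial d q f *m monomial c (dot b) (+%R^~ a) *m (monomial d q f)^t* =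
  monomial c (fun v => q (g v + a) - q (g v) + dot b (g v))
    (fun v => f (g v + a)).
Proof.
move=> fK gK d_phase; rewrite (monomial_adj _ _ fK gK) !monomial_mul.
rewrite mulrAC phases_conj // mul1r.
by apply: eq_monomial => v //=; rewrite F2_oppr; ring.
Qed.

(** * The Pauli group in the form c X^a Z^b *)

Definition pauli1 x y : 'M[R[i]]_2 :=
  if x == 0 then if y == 0 then 1%:M else pauliZ
  else if y == 0 then pauliX else pauliY.

(** The phase in Y = i X Z. *)
Definition pauli1_phase x y : R[i] := if x * y == 0 then 1 else 'i%R.

Lemma pauli1E x y (u v : 'F_2) :
  pauli1 x y u v = pauli1_phase x y * sgn (y * v) * (u == v + x)%:R.
Proof.
rewrite /pauli1 /pauli1_phase.
case: (F2_cases x) => ->; case: (F2_cases y) => -> /=;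
case: (F2_cases u) => ->; case: (F2_cases v) => -> /=;
rewrite !mxE /sgn /=; ring.
Qed.

Lemma pauli1_phase_in x y : pauli1_phase x y \in phases.
Proof. by rewrite /pauli1_phase !inE; case: ifP; rewrite eqxx ?orbT. Qed.

Lemma pauli1P (P : 'M[R[i]]_2) :
  reflect (exists x y, P = pauli1 x y)
          (P \in [:: 1%:M; pauliX; pauliY; pauliZ]).
Proof.
rewrite !inE; apply: (iffP or4P) => [[] /eqP -> | [x [y ->]]].
- by exists 0, 0.
- by exists 1, 0.
- by exists 1, 1.
- by exists 0, 1.
rewrite /pauli1; case: ifP; case: ifP => _ _; by constructor.
Qed.

Lemma tensor_pauli1 a b :
  tensor (fun j => pauli1 (a 0 j) (b 0 j)) =
  monomial (\prod_j pauli1_phase (a 0 j) (b 0 j)) (dot b) (+%R^~ a).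
Proof.
apply: eq_gate_of => u v; rewrite sgn_sum.
transitivity (\prod_j (pauli1_phase (a 0 j) (b 0 j) * sgn (b 0 j * v 0 j)
  * (u 0 j == v 0 j + a 0 j)%:R)).
  by apply: eq_bigr => j _; rewrite pauli1E.
rewrite !big_split /=; congr (_ * _).
case: eqP => [-> | neq_uv].
  by rewrite big1 // => j _; rewrite !mxE eqxx.
have [j neq_j] : exists j, u 0 j != v 0 j + a 0 j.
  apply/existsP; apply: contra_notT neq_uv => /existsPn eq_uv.
  by apply/rowP => j; rewrite mxE; apply/eqP; have := eq_uv j; rewrite negbK.
by rewrite (bigD1 j) //= (negPf neq_j) mul0r.
Qed.

Lemma pauliP P : pauli_group P <->
  exists c a b, c \in phases /\ P = monomial c (dot b) (+%R^~ a).
Proof.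
have scaleE c d q f : c *: monomial d q f = monomial (c * d) q f.
  by apply/matrixP => i j; rewrite !mxE !mulrA.
have prod_phase a b : \prod_j pauli1_phase (a 0 j) (b 0 j) \in phases.
  apply: (big_ind (fun z => z \in phases)) => [|c d|j _].
  - by rewrite phasesE expr1n.
  - exact: phasesM.
  exact: pauli1_phase_in.
split=> [[c [F [c_phase F_pauli ->]]] | [c [a [b [c_phase ->]]]]].
  have /fin_all_exists[xy F_xy] j : exists xy, F j = pauli1 xy.1 xy.2.
    by have /pauli1P[x [y ->]] := F_pauli j; exists (x, y).
  pose a := \row_j (xy j).1; pose b := \row_j (xy j).2.
  exists (c * \prod_j pauli1_phase (a 0 j) (b 0 j)), a, b.
  split; first exact: phasesM.
  rewrite -scaleE -tensor_pauli1; congr (_ *: _); apply: eq_gate_of => u v.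
  by apply: eq_bigr => j _; rewrite !mxE F_xy.
pose d := \prod_j pauli1_phase (a 0 j) (b 0 j).
(* The factor [d^*] cancels the phase [d] that the tensor product carries. *)
exists (c * d^*%R), (fun j => pauli1 (a 0 j) (b 0 j)); split.
- by apply: phasesM => //; apply/phases_conj_in/prod_phase.
- by move=> j; apply/pauli1P; exists (a 0 j), (b 0 j).
rewrite tensor_pauli1 scaleE -mulrA [_ * d]mulrC phases_conj ?mulr1 //.
exact: prod_phase.
Qed.

(** A finite enumeration of the Pauli group, so that an injection into itself can be shown onto by
    counting. *)
Definition paulis : seq (gate R n) :=
  [seq monomial c (dot ab.2) (+%R^~ ab.1) | c <- phases,
                                            ab <- enum {: bits n * bits n}].

Lemma mem_paulis P : (P \in paulis) <-> pauli_group P.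
Proof.
rewrite pauliP; split=> [/allpairsP[[c [a b]] /= [c_phase _ ->]]|].
  by exists c, a, b.
move=> [c [a [b [c_phase ->]]]]; apply/allpairsP; exists (c, (a, b)).
by rewrite mem_enum.
Qed.

(** * The Clifford group and its action on the third level *)

Lemma unitary_adjK U : U \is unitarymx -> U^t* *m U = 1%:M.
Proof. by move=> /unitarymxP /mulmx1C. Qed.

Lemma trmxC_mul U V : (U *m V)^t* = V^t* *m U^t*.
Proof. by rewrite trmx_mul map_mxM. Qed.

Lemma clifford_mul U V : clifford U -> clifford V -> clifford (U *m V).
Proof.
move=> [uU cU] [uV cV]; split=> [|P /cV/cU]; first exact: mul_unitarymx.
by rewrite trmxC_mul !mulmxA.
Qed.

(* Conjugation by a Clifford gate is an injection of the finite Pauli group into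
   itself, hence onto. *)
Lemma clifford_adj U : clifford U -> clifford (U^t*).
Proof.
move=> [uU cU]; split=> [|P pP]; first by rewrite trmxC_unitary.
pose conjU Q := U *m Q *m U^t*.
have conjU_inj : injective conjU.
  move=> Q Q' /(congr1 (fun W => U^t* *m W *m U)).
  by rewrite /conjU !mulmxA unitary_adjK // !mul1mx -!mulmxA unitary_adjK // !mulmx1.
have onto : map conjU (undup paulis) =i undup paulis.
  apply: (uniq_min_size _ _ _).2; rewrite ?map_inj_uniq ?undup_uniq ?size_map //.
  move=> _ /mapP[Q + ->]; rewrite !mem_undup => /mem_paulis/cU pUQ.
  exact/mem_paulis.
have : P \in undup paulis by rewrite mem_undup; apply/mem_paulis.
rewrite -onto => /mapP[Q]; rewrite mem_undup => /mem_paulis pQ ->.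
rewrite trmxCK /conjU !mulmxA unitary_adjK // mul1mx.
by rewrite -mulmxA unitary_adjK // mulmx1.
Qed.

(** [M] carries P to a Pauli gate, [U] carries that to a Clifford gate, and conjugation by [L] stays
    in the Clifford group. *)
Lemma clifford_hierarchy3_mulmx L U M : clifford L -> clifford M ->
  clifford_hierarchy 3 U -> clifford_hierarchy 3 (L *m U *m M).
Proof.
move=> cL [uM cM] [uU cU]; split=> [|P /cM/cU cW].
  by rewrite !mul_unitarymx //; case: cL.
have := clifford_mul (clifford_mul cL cW) (clifford_adj cL).
by rewrite !trmxC_mul !mulmxA.
Qed.

(** * Monomial gates in the hierarchy *)

Lemma monomial_pauli c q a : c \in phases -> affine q ->
  pauli_group (monomial c q (+%R^~ a)).
Proof.
move=> c_phase /affine_dot[b q_b]; apply/pauliP.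
exists (c * sgn (q 0)), a, b; split; first exact/phasesM/phases_sgn.
by apply: eq_gate_of => u v; rewrite q_b sgnD; ring.
Qed.

(** Conjugating X^a Z^b gives a translation, as [f] is affine, with sign exponent a first difference
    of [q] plus a linear form, both composed with the affine [g]. *)
Lemma monomial_clifford c q f g : cancel f g -> cancel g f ->
  c \in phases -> affine f -> quadratic q -> clifford (monomial c q f).
Proof.
move=> fK gK c_phase af qq; split; first exact: monomial_unitary gK _.
move=> _ /pauliP[d [a [b [d_phase ->]]]]; rewrite (@monomial_conj _ _ _ _ g) //.
have ag := affine_inv fK gK af.
rewrite (eq_monomial _ (frefl _) (fun v => affine_translate a v gK af)).
apply/monomial_pauli/affineD => //.
  exact: affine_comp (qq a) ag.
exact: affine_comp (dot_affine b) ag.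
Qed.

Lemma perm_gate_permutation f g : cancel f g -> cancel g f ->
  permutation_gate (monomial 1 (fun=> 0) f).
Proof.
move=> fK gK; split; first by apply: monomial_unitary gK _; rewrite ?inE ?eqxx.
have gI : injective (fun i : 'I_#|{: bits n}| => enum_rank (g (enum_val i))).
  by move=> i j /enum_rank_inj/(can_inj gK)/enum_val_inj.
apply/is_perm_mxP; exists (perm gI); apply/matrixP => i j.
rewrite !mxE permE sgn0 !mul1r -(can2_eq gK fK); congr (_%:R).
by rewrite -(inj_eq enum_rank_inj) enum_valK.
Qed.

(* Only the inverse of f has to be quadratic: this asymmetry is what separates a
   gate from its adjoint. *)
Lemma permutation_hierarchy3 f g : cancel f g -> cancel g f ->
  (forall a, affine (fun v => f (g v + a))) ->
  (forall j, quadratic (fun v => g v 0 j)) ->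
  clifford_hierarchy 3 (monomial 1 (fun=> 0) f).
Proof.
move=> fK gK af qg; have one_phase : 1 \in phases by rewrite inE eqxx.
split; first exact: monomial_unitary gK _.
move=> _ /pauliP[d [a [b [d_phase ->]]]]; rewrite (@monomial_conj _ _ _ _ g) //.
(* The permutation part of U X^a Z^b U^-1 is its own inverse because 2a = 0. *)
have tauK : involutive (fun v => f (g v + a)).
  by move=> v; rewrite fK -addrA bits_addrr addr0 gK.
apply: (monomial_clifford tauK tauK) => // a' x y z.
have := quadratic_lincomb b qg a' x y z.
by rewrite !subrr !add0r.
Qed.

Lemma pauli_monomial_affine q f :
  pauli_group (monomial 1 q f) -> affine q.
Proof.
move=> /pauliP[c [a [b [c_phase eq_q]]]].
have sgn_q v : sgn (q v) = c * sgn (dot b v).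
  by have [] := monomial_inj v (oner_neq0 _) eq_q; rewrite mul1r.
have q_b v : q v = q 0 + dot b v.
  by apply: sgn_inj; rewrite sgnD !sgn_q dot_0r sgn0 mulr1.
by move=> x y z; rewrite (q_b (_ - z)) (q_b x) (q_b y) (q_b z) dot_affine; ring.
Qed.

(** U Z^b U^-1 is diagonal with sign exponent b . g(v). Being Clifford, it conjugates X^a to a Pauli
    gate whose sign exponent, a first difference of b . g, must be affine. *)
Lemma hierarchy3_inv_quadratic f g b : cancel f g -> cancel g f ->
  clifford_hierarchy 3 (monomial 1 (fun=> 0) f) ->
  quadratic (fun v => dot b (g v)).
Proof.
have one_phase : 1 \in phases by rewrite inE eqxx.
move=> fK gK [_ cU] a.
have pauli_ab a' b' : pauli_group (monomial 1 (dot b') (+%R^~ a')).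
  by apply/pauliP; exists 1, a', b'.
have [_ /(_ _ (pauli_ab a 0))] := cU _ (pauli_ab 0 b).
rewrite (@monomial_conj _ _ _ _ g) //.
have -> : monomial 1 (fun v => 0 - 0 + dot b (g v)) (fun v => f (g v + 0))
    = monomial 1 (fun v => dot b (g v)) id.
  by apply: eq_monomial => v; rewrite ?subrr ?add0r // addr0 gK.
rewrite (@monomial_conj _ _ _ _ id) // => /pauli_monomial_affine aq x y z.
by have := aq x y z; rewrite !dot_0l !addr0.
Qed.

(** * Products of commuting Toffoli gates *)

Lemma toffoli_adj U : toffoli_gate U -> U^t* = U.
Proof.
move=> [i [j [k [ij jk ik ->]]]].
(* The target differs from both controls, so the same product is added twice. *)
have tofK : involutive (toffoli_map i j k).
  move=> v; apply/rowP => l; rewrite !mxE.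
  case: eqP => // ->; rewrite eqxx (negPf ik) (negPf jk).
  by rewrite -addrA F2_addrr addr0.
have -> : toffoli i j k = monomial 1 (fun=> 0) (toffoli_map i j k).
  by apply: eq_gate_of => u v; rewrite sgn0 !mul1r.
by rewrite (monomial_adj _ _ tofK tofK) conjC1.
Qed.

(** The adjoint only reverses the order of self-adjoint factors, and commutation restores it. *)
Lemma commuting_toffoli_product_adj V : commuting_toffoli_product V -> V^t* = V.
Proof.
move=> [s [tof_s comm_s ->]]; elim: s => [|T s IHs] in tof_s comm_s *.
  by rewrite big_nil trmx1 map_mx1.
have sTs : {subset s <= T :: s} by move=> W Ws; rewrite inE Ws orbT.
rewrite big_cons trmxC_mul IHs; first last.
- by move=> W W' Ws W's; apply: comm_s; apply: sTs.
- by move=> W Ws; apply: tof_s; apply: sTs.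
rewrite (toffoli_adj (tof_s T (mem_head _ _))).
suff : comm_mx T (\big[mulmx/1%:M]_(W <- s) W) by [].
rewrite big_seq; apply: (big_ind (fun W => comm_mx T W)).
- exact: comm_mx1.
- move=> W W'; exact: comm_mxM.
by move=> W Ws; apply: comm_s; [exact: mem_head | exact: sTs].
Qed.

Lemma commuting_toffoli_adj_hierarchy3 U :
  clifford_hierarchy 3 U -> commuting_toffoli_product_up_to_clifford U ->
  clifford_hierarchy 3 (U^t*).
Proof.
move=> cU [L [V [M [cL /commuting_toffoli_product_adj V_adj cM eqU]]]].
have C_clifford := clifford_mul (clifford_adj cM) (clifford_adj cL).
(* Substitute V = L^-1 U M^-1 into U^-1 = M^-1 V L^-1. *)
suff -> : U^t* = M^t* *m L^t* *m U *m (M^t* *m L^t*).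
  exact: clifford_hierarchy3_mulmx.
have [[uL _] [uM _]] := (cL, cM).
by rewrite eqU !trmxC_mul V_adj !mulmxA mulmxKtV // mulmxtVK.
Qed.

End Gates.

(** * The counterexample on seven qubits *)

(* x : bits 7 stands for the element of the augmentation ideal of
   F_2[e1,e2,e3]/(e1^2,e2^2,e3^2) with coordinates x#0, ..., x#6 along
   e1, e2, e3, e1e2, e1e3, e2e3, e1e2e3. *)
Definition bits7 (s : seq 'F_2) : bits 7 := \row_j s`_j.

Local Notation "x # k" := (x 0 (inord k : 'I_7)) (at level 2, format "x # k").

Lemma bits7E s k : (k < 7)%N -> (bits7 s)#k = s`_k.
Proof. by move=> lt_k7; rewrite mxE inordK. Qed.

Lemma ord7_ind (P : 'I_7 -> Prop) :
  [/\ P (inord 0), P (inord 1), P (inord 2) & P (inord 3)] ->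
  [/\ P (inord 4), P (inord 5) & P (inord 6)] -> forall j, P j.
Proof.
move=> [P0 P1 P2 P3] [P4 P5 P6] j; rewrite -(inord_val j).
by case: j => -[|[|[|[|[|[|[|k]]]]]]].
Qed.

(* 1 + exterior_exp x is the product of the (1 + e_S)^(x_S) over the monomials
   e_S. *)
Definition exterior_exp (x : bits 7) : bits 7 :=
  bits7 [:: x#0; x#1; x#2;
            x#3 + x#0 * x#1; x#4 + x#0 * x#2;
            x#5 + x#1 * x#2;
            x#6 + x#0 * x#5 + x#1 * x#4 + x#2 * x#3
            + x#0 * x#1 * x#2].

(** Back substitution in [exterior_exp] would add 2 x#0 x#1 x#2 to the last coordinate; it vanishes
    mod 2. *)
Definition exterior_log (x : bits 7) : bits 7 :=
  bits7 [:: x#0; x#1; x#2;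
            x#3 - x#0 * x#1; x#4 - x#0 * x#2;
            x#5 - x#1 * x#2;
            x#6 - x#0 * x#5 - x#1 * x#4 - x#2 * x#3].

(* 1 + circle x y is the product (1 + x)(1 + y). *)
Definition circle (x y : bits 7) : bits 7 :=
  bits7 [:: x#0 + y#0; x#1 + y#1; x#2 + y#2;
            x#3 + y#3 + x#0 * y#1 + x#1 * y#0;
            x#4 + y#4 + x#0 * y#2 + x#2 * y#0;
            x#5 + y#5 + x#1 * y#2 + x#2 * y#1;
            x#6 + y#6 + x#0 * y#5 + x#5 * y#0 + x#1 * y#4 + x#4 * y#1
            + x#2 * y#3 + x#3 * y#2].

Lemma exterior_expK : cancel exterior_exp exterior_log.
Proof.
move=> x; apply/rowP; apply: ord7_ind; split; rewrite !bits7E //=; try ring.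
(* Only the last coordinate needs characteristic 2: one cubic term comes from the exponential, three
   from the corrections. *)
have two0 : 1 + 1 = 0 :> 'F_2 by apply: F2_addrr.
transitivity (x#6 - (1 + 1) * (x#0 * x#1 * x#2)); first ring.
by rewrite two0 mul0r subr0.
Qed.

Lemma exterior_logK : cancel exterior_log exterior_exp.
Proof.
move=> x; apply/rowP; apply: ord7_ind; split; rewrite !bits7E //=; try ring.
have two0 : 1 + 1 = 0 :> 'F_2 by apply: F2_addrr.
transitivity (x#6 - (1 + 1) * (x#0 * x#1 * x#2)); first ring.
by rewrite two0 mul0r subr0.
Qed.

Lemma exterior_log_quadratic j : quadratic (fun v => exterior_log v 0 j).
Proof.
move: j; apply: ord7_ind; split=> a x y z; rewrite !bits7E //= !mxE; ring.
Qed.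

(** Each factor is 1 + x_S e_S with e_S^2 = 0, so exponents add. *)
Lemma exterior_expD x a :
  exterior_exp (x + a) = circle (exterior_exp x) (exterior_exp a).
Proof.
apply/rowP; apply: ord7_ind; split; rewrite !bits7E //= !mxE ?inordK //=; ring.
Qed.

Lemma exterior_exp_translate_affine a :
  affine (fun v => exterior_exp (exterior_log v + a)).
Proof.
(* What remains is [circle] with its second argument fixed, affine in the first. *)
move=> x y z; rewrite !exterior_expD !exterior_logK; move: (exterior_exp a) => c.
apply/rowP; apply: ord7_ind; split;
  by rewrite [LHS]bits7E // ![in RHS]mxE !inordK //= !mxE; ring.
Qed.

Lemma exterior_exp_not_quadratic :
  ~ quadratic (fun v => dot ('e_(inord 6)) (exterior_exp v)).
Proof.
have dotE v : dot 'e_(inord 6) (exterior_exp v) = (exterior_exp v)#6.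
  rewrite /dot (bigD1 (inord 6)) //= big1 => [|j neq_j].
    by rewrite mxE !eqxx mul1r addr0.
  by rewrite mxE (negPf neq_j) andbF mul0r.
pose e k : bits 7 := 'e_(inord k).
(* At these points only x#0 x#1 x#2 at e1 + e2 + e3 survives, and the identity reads 1 = 0. *)
move/(_ (e 2) (e 0) (e 1) 0); rewrite !dotE !bits7E //= !mxE.
by rewrite -!val_eqE /= !inordK.
Qed.

Theorem proposition5p13 (R : realType) :
  ~ (forall n : nat, (0 < n)%N -> forall U : gate R n, permutation_gate U ->
       (clifford_hierarchy 3 U <-> commuting_toffoli_product_up_to_clifford U))
  /\
  ~ (forall n k : nat, (0 < n)%N -> (0 < k)%N ->
       forall U : gate R n, permutation_gate U ->
       clifford_hierarchy k U -> clifford_hierarchy k (U ^t*)).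
Proof.
have permU := perm_gate_permutation (R := R) exterior_expK exterior_logK.
have hierU := permutation_hierarchy3 (R := R) exterior_expK exterior_logK
  exterior_exp_translate_affine exterior_log_quadratic.
set U := monomial 1 _ exterior_exp in permU hierU.
have not_hier_adj : ~ clifford_hierarchy 3 (U^t*).
  rewrite (monomial_adj _ _ exterior_expK exterior_logK) conjC1.
  (* The adjoint is the gate of the logarithm, so the inverse that would be quadratic is the
     exponential. *)
  move=> /(hierarchy3_inv_quadratic 'e_(inord 6) exterior_logK exterior_expK).
  exact: exterior_exp_not_quadratic.
(* Either assertion, at n = 7 and level 3, would put the adjoint of [U] in the third level. *)
split=> [toffoli_iff | adj_closed]; apply: not_hier_adj; last exact: adj_closed.
apply: commuting_toffoli_adj_hierarchy3 => //.
by apply/(toffoli_iff 7%N isT U permU).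
Qed.
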